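(* Let $S$ be a linear operator acting on a complex Hilbert space $\mathcal{H}$. The following statements are equivalent: (i) $S$ is (densely defined and) selfadjoint; (ii) (a) $S\wedge S$; (b) $\operatorname{ran}(\lambda i+S)=\mathcal{H}$; (c) $\overline{\operatorname{ran}(\lambda i-S)}=\mathcal{H}$, for a certain (and also for all) $\lambda\in\mathbb{R}$, $\lambda\neq0$.
   Context: A linear operator $S$ on $\mathcal{H}$ is a linear map $S:\operatorname{dom}S\to\mathcal{H}$ defined on a linear subspace $\operatorname{dom}S\subseteq\mathcal{H}$; it is not assumed bounded, closed or densely defined. The operators $\lambda i\pm S$ have domain $\operatorname{dom}S$. The adjoint $S^*$ of a densely defined $S$ has domain $\{k:\exists h'\ \forall h\in\operatorname{dom}S,\ \langle Sh,k\rangle=\langle h,h'\rangle\}$ and $S^*k:=h'$. $S$ is selfadjoint if it is densely defined and $S=S^*$ (with equal domains). $S\wedge S$ means $\langle Sh,k\rangle=\langle h,Sk\rangle$ for all $h,k\in\operatorname{dom}S$ (no density of the domain assumed). ''For a certain (and also for all) $\lambda$'' means: statement (ii) with ''for some $\lambda$'' (the same $\lambda$ in (b) and (c)) and statement (ii) with ''for all $\lambda$'' are both equivalent to (i). *)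

(* Defs.v *)
From HB Require Import structures.
From mathcomp Require Import all_boot all_order all_algebra complex.
From mathcomp Require Import all_classical all_reals all_analysis.

Set Implicit Arguments.
Unset Strict Implicit.
Unset Printing Implicit Defensive.

Import Order.TTheory GRing.Theory Num.Theory.
Import numFieldNormedType.Exports.

Local Open Scope classical_set_scope.
Local Open Scope complex_scope.
Local Open Scope ring_scope.

(* The inner product is linear in its first argument and conjugate-linear in
   its second one.  The norm takes its values in the numFieldType R[i], as does
   every norm of a normedModType R[i]. *)
HB.mixin Record isHilbert (R : realType) H & CompleteNormedModule R[i] H := {
  inner : {dot H for Num.conj} ;
  inner_norm : forall x : H, inner x x = `|x| ^+ 2
}.

#[short(type="hilbertType")]
HB.structure Definition Hilbert (R : realType) :=
  { H of CompleteNormedModule R[i] H & isHilbert R H }.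

Section Operators.
Context {R : realType} {H : hilbertType R}.

(* Only the values of op on dom are meaningful. *)
Record operator := Operator { dom : set H ; op :> H -> H }.

Definition linear_operator (S : operator) : Prop :=
  [/\ dom S 0,
      forall (a : R[i]) (x y : H), dom S x -> dom S y -> dom S (a *: x + y) &
      forall (a : R[i]) (x y : H), dom S x -> dom S y ->
        S (a *: x + y) = a *: S x + S y].

Definition eq_operator (S T : operator) : Prop :=
  dom S = dom T /\ forall h, dom S h -> S h = T h.

Definition ran (S : operator) : set H := [set S h | h in dom S].

Definition scalar_add (c : R[i]) (S : operator) : operator :=
  Operator (dom S) (fun h => c *: h + S h).

Definition scalar_sub (c : R[i]) (S : operator) : operator :=
  Operator (dom S) (fun h => c *: h - S h).

Definition adjoint_values (S : operator) (k : H) : set H :=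
  [set h' | forall h, dom S h -> inner (S h) k = inner h h'].

(* The adjoint is meaningful for a densely defined S only: adjoint_values S k
   is then empty or a singleton. *)
Definition adjoint (S : operator) : operator :=
  Operator [set k | adjoint_values S k !=set0]
           (fun k => xget 0 (adjoint_values S k)).

Definition selfadjoint (S : operator) : Prop :=
  dense (dom S) /\ eq_operator S (adjoint S).

(* No density of the domain is required. *)
Definition symmetric_operator (S : operator) : Prop :=
  forall h k, dom S h -> dom S k -> inner (S h) k = inner h (S k).

End Operators.

Arguments operator {R} H.

(* Main.v *)
Require Import Defs.
From HB Require Import structures.
From mathcomp Require Import all_boot all_order all_algebra complex ring.
From mathcomp Require Import all_classical all_reals all_analysis.

Import Order.TTheory GRing.Theory Num.Theory.
Import numFieldNormedType.Exports.

Local Open Scope classical_set_scope.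
Local Open Scope complex_scope.
Local Open Scope ring_scope.

(**
The proof rests on one property of symmetric operators and one of Hilbert
spaces.  Write mu for lambda i, so that mu is nonzero and conj mu = - mu.

If S is symmetric, the cross terms of ||mu x + S x||^2 cancel, because mu is
purely imaginary and <x, S x> is real; hence
||mu x + S x||^2 = |mu|^2 ||x||^2 + ||S x||^2 ([norm_imaginary_add]), and
preimages under mu + S are controlled by their images.  In a Hilbert space,
a subspace whose orthogonal complement is trivial is dense, by orthogonal
projection onto its closure ([orthogonal_dense]).

From (i) to (ii).  A vector k orthogonal to ran (mu + S) satisfies
<S h, k> = <h, mu k> on dom S, so S^* k = mu k, that is S k = mu k; symmetry
then forces <k, k> = 0.  So ran (mu + S) is dense.  It is also everything:
for a given y, approximate solutions of mu h + S h = y are Cauchy by the bound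
above, and their limit h satisfies S^* h = y - mu h, hence S h = y - mu h
([selfadjoint_ran]).  The range of mu - S is, up to sign, that of - mu + S,
so the same argument with - mu gives (c).

From (ii) to (i), for one mu.  Symmetry says that
<mu x - S x, y> = - <x, mu y + S y> on dom S.  If k is orthogonal to dom S,
solve k = mu h + S h; then h is orthogonal to the dense subspace ran (mu - S),
so h = 0 and k = 0, and dom S is dense.  If h is in the domain of S^* with
S^* h = k', solve mu h + k' = mu g + S g; the same identity makes h - g
orthogonal to ran (mu - S), so h = g lies in dom S and S h = k'
([selfadjoint_of_ran]).
*)

(** * Inner products and orthogonality in a Hilbert space *)

Section HilbertSpace.
Context {R : realType} {H : hilbertType R}.
Implicit Types (x y z u v w : H) (c e mu : R[i]) (M : set H).

Lemma innerC u v : inner v u = Num.conj (inner u v).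
Proof. by rewrite (hermC inner v u) expr0 mul1r. Qed.

Lemma innerZl c u v : inner (c *: u) v = c * inner u v.
Proof. by rewrite linearZl_LR. Qed.

Lemma innerZr c u v : inner u (c *: v) = Num.conj c * inner u v.
Proof. by rewrite linearZr_LR. Qed.

Lemma innerDl u v w : inner (u + v) w = inner u w + inner v w.
Proof. by rewrite linearDl. Qed.

Lemma innerBl u v w : inner (u - v) w = inner u w - inner v w.
Proof. by rewrite linearBl. Qed.

Lemma innerDr u v w : inner w (u + v) = inner w u + inner w v.
Proof. by rewrite linearDr. Qed.

Lemma innerBr u v w : inner w (u - v) = inner w u - inner w v.
Proof. by rewrite linearBr. Qed.

Lemma inner_eq0 u : inner u u = 0 -> u = 0.
Proof. by move/eqP; rewrite dnorm_eq0 => /eqP. Qed.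

Lemma scalar_i_imaginary (lambda : R) : lambda != 0 ->
  let mu := lambda%:C * 'i%C in mu != 0 /\ Num.conj mu = - mu.
Proof.
move=> l0 /=; split.
  by apply/eqP => -[_ /eqP]; rewrite mulr1 mul0r addr0; exact/negP.
apply/eqP; rewrite eq_complex /=.
by rewrite !(mulr0, mul0r, mulr1, addr0, subr0, oppr0) !eqxx.
Qed.

Lemma closure_distP M x :
  closure M x <-> forall e, 0 < e -> exists2 m, M m & `|x - m| < e.
Proof.
split=> [Mx e e0|Mx B].
  have [m [Mm xm]] := Mx _ (nbhsx_ballx x e e0).
  by exists m => //; move: xm; rewrite -ball_normE.
move=> /nbhs_ballP[e /= e0 eB]; have [m Mm xm] := Mx e e0.
by exists m; split=> //; apply: eB; rewrite -ball_normE.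
Qed.

Lemma denseP M : dense M <-> closure M = setT.
Proof.
split=> [dM|cM].
  apply/seteqP; split=> // x _ B /nbhs_interior Bx.
  have [m [Bm Mm]] :=
    dM _ (ex_intro _ x (nbhs_singleton Bx)) (@open_interior _ B).
  by exists m; split=> //; apply: interior_subset Bm.
move=> O [x Ox] oO; have : closure M x by rewrite cM.
by move=> /(_ O (open_nbhs_nbhs (conj oO Ox)))[m [Mm Om]]; exists m.
Qed.

(** Cantor's intersection theorem, for a family indexed by the positive
    tolerances.  It turns completeness into existence of solutions, with [A e]
    the set of approximate solutions up to [e]. *)
Lemma cantor_intersection (A : R[i] -> set H) (K : R[i]) : 0 < K ->
  (forall e, 0 < e -> A e !=set0) ->
  (forall e e', 0 < e -> e <= e' -> A e `<=` A e') ->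
  (forall e x y, 0 < e -> A e x -> A e y -> `|x - y| < e * K) ->
  exists z, forall e, 0 < e -> closure (A e) z.
Proof.
move=> K0 A0 Ale Ad.
(* The sets [A e] form a Cauchy filter base. *)
pose F : set_system H := filter_from [set e | 0 < e] A.
have FF : ProperFilter F.
  apply: filter_from_proper => //.
  apply: filter_from_filter; first by exists 1; rewrite /= ltr01.
  move=> e e' /= e0 e'0.
  have /orP[ee'|e'e] := real_comparable (gtr0_real e0) (gtr0_real e'0).
    by exists e => // x Ax; split=> //; exact: Ale ee' _ Ax.
  by exists e' => // x Ax; split=> //; exact: Ale e'e _ Ax.
have Fc : cvg F.
  apply: cauchy_cvg; apply: cauchy_exP => e e0.
  have eK0 : 0 < e / K by rewrite divr_gt0.
  have [x Ax] := A0 _ eK0.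
  exists x; exists (e / K) => // y Ay; rewrite -ball_normE /=.
  by rewrite (lt_le_trans (Ad _ _ _ eK0 Ax Ay))// divfK// gt_eqF.
exists (lim F) => e e0 B /Fc [e' /= e'0 A'B].
have /orP[ee'|e'e] := real_comparable (gtr0_real e0) (gtr0_real e'0).
  by have [x Ax] := A0 _ e0; exists x; split=> //; apply/A'B/(Ale _ _ e0 ee').
have [x Ax] := A0 _ e'0; exists x.
by split; [exact: Ale e'e _ Ax|exact: A'B].
Qed.

(** Pythagoras for [u] minus its component along [v].  As the left-hand side is
    nonnegative this contains the Cauchy-Schwarz inequality, and it measures
    how much a distance to a subspace can be decreased by moving along [v]. *)
Lemma norm_sub_proj u v : v != 0 ->
  `|u - (inner u v / `|v| ^+ 2) *: v| ^+ 2 =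
  `|u| ^+ 2 - (`|inner u v| / `|v|) ^+ 2.
Proof.
move=> v0; have nv0 : `|v| != 0 by rewrite normr_eq0.
set c := inner u v / _.
have ou : inner (u - c *: v) v = 0.
  by rewrite innerBl innerZl inner_norm /c divfK ?subrr// expf_neq0.
have := dnormD inner (u - c *: v) (c *: v).
rewrite subrK innerZr ou mulr0 /= conjC0 !addr0 dnormZ !inner_norm => ->.
rewrite /c normf_div normrX normr_id; field.
exact: nv0.
Qed.

Lemma cauchy_schwarz u v : `|inner u v| <= `|u| * `|v|.
Proof.
have [->|v0] := eqVneq v 0; first by rewrite linear0r !normr0 mulr0.
have nv0 : 0 < `|v| by rewrite normr_gt0.
rewrite -ler_pdivrMr// -ler_sqr ?nnegrE ?divr_ge0//.
by rewrite -subr_ge0 -norm_sub_proj// exprn_ge0.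
Qed.

(** Continuity of the inner product, for limits given as points of all the
    closures of the approximating sets [A e]. *)
Lemma inner_limit (A : R[i] -> set H) (K : R[i]) z w c : 0 < K ->
  (forall e, 0 < e -> closure (A e) z) ->
  (forall e x, 0 < e -> A e x -> `|c - inner x w| <= e * K) ->
  inner z w = c.
Proof.
move=> K0 Az Aw; apply/eqP; rewrite eq_sym -subr_eq0 -normr_eq0.
apply/negP => /negP ncz.
have {}ncz : 0 < `|c - inner z w| by rewrite lt_def ncz normr_ge0.
have Kw0 : 0 < K + `|w| by rewrite ltr_wpDr.
(* With this tolerance, the error is at most half of itself. *)
pose e := `|c - inner z w| / (K + `|w|) / 2.
have e0 : 0 < e by rewrite !divr_gt0.
have [x Ax zx] := (closure_distP _ _).1 (Az e e0) e e0.
have : `|c - inner z w| <= e * (K + `|w|).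
  rewrite (_ : c - _ = (c - inner x w) + inner (x - z) w); last first.
    by rewrite innerBl addrA subrK.
  rewrite mulrDr (le_trans (ler_normD _ _))// lerD ?Aw//.
  by rewrite (le_trans (cauchy_schwarz _ _))// ler_wpM2r// distrC ltW.
rewrite /e mulrAC divfK ?gt_eqF//.
rewrite ler_pdivlMr// mulr_natr mulr2n gerDl => /(lt_le_trans ncz).
by rewrite ltxx.
Qed.

(** The norm takes its values in [R[i]], whose order is partial; the infimum is
    taken over the real parts and injected back. *)
Lemma min_dist M y : M !=set0 -> exists d : R[i],
  (forall m, M m -> d <= `|y - m| ^+ 2) /\
  (forall e, 0 < e -> exists2 m, M m & `|y - m| ^+ 2 < d + e).
Proof.
move=> M0.
have RN x : (complex.Re (`|x| ^+ 2))%:C = `|x| ^+ 2.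
  by rewrite RRe_real// realX// normr_real.
pose E := [set complex.Re (`|y - m| ^+ 2) | m in M].
have Einf : has_inf E.
  split; first by case: M0 => m Mm; exists (complex.Re (`|y - m| ^+ 2)), m.
  exists 0 => _ [m Mm <-].
  by rewrite -ler0c RN exprn_ge0.
exists (inf E)%:C; split=> [m Mm|e e0].
  by rewrite -RN lecR; apply: ge_inf => //; [exact: Einf.2 | exists m].
have eE : e = (complex.Re e)%:C by rewrite RRe_real// gtr0_real.
rewrite eE ltcR in e0.
have [_ [m Mm <-] me] := inf_adherent e0 Einf.
by exists m => //; rewrite eE -rmorphD -RN ltcR.
Qed.

Lemma parallelogram u v :
  `|u + v| ^+ 2 + `|u - v| ^+ 2 = (`|u| ^+ 2 + `|v| ^+ 2) *+ 2.
Proof. by rewrite -!inner_norm dnormD dnormB /= mulr2n addrACA subrr addr0. Qed.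

Definition subspace M :=
  M 0 /\ forall (a : R[i]) x y, M x -> M y -> M (a *: x + y).

(** The points of [M] nearly closest to [y] are close to one another by the
    parallelogram law, since their midpoint is in [M] as well.  At a limit [z]
    of such points, a nonzero component of [y - z] along some [m] in [M] would
    allow a smaller distance. *)
Lemma orthogonal_projection M y : subspace M ->
  exists2 z, closure M z & forall m, M m -> inner (y - z) m = 0.
Proof.
move=> [M0 MD].
have [d [dM Md]] := @min_dist M y (ex_intro _ 0 M0).
(* The squared tolerance makes the diameter of [A e] linear in [e]. *)
pose A e := [set m | M m /\ `|y - m| ^+ 2 < d + e ^+ 2].
have [z Az] : exists z, forall e, 0 < e -> closure (A e) z.
  apply: (@cantor_intersection A 2) => //.
  - move=> e e0; have [|m Mm ym] := Md (e ^+ 2); last by exists m.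
    by rewrite exprn_gt0.
  - move=> e e' e0 ee' x [Mx yx]; split=> //; apply: (lt_le_trans yx).
    by rewrite lerD2l ler_sqr// nnegrE ltW// (lt_le_trans e0).
  - move=> e m m' e0 [Mm ym] [Mm' ym'].
    have e20 : 0 < e * 2 by rewrite mulr_gt0.
    rewrite -ltr_sqr ?nnegrE ?(ltW e20)//.
    have := parallelogram (y - m) (y - m').
    have -> : y - m - (y - m') = m' - m.
      by rewrite opprB addrACA addrC addrA subrK addrC.
    rewrite [`|m - m'|]distrC.
    set p := _ + (y - m') => sum_eq.
    have dp : d *+ 4 <= `|p| ^+ 2.
      have -> : p = 2 *: (y - (2^-1 *: m + 2^-1 *: m')).
        rewrite -scalerDr scalerBr scalerA divff// scale1r.
        by rewrite scaler_nat mulr2n opprD addrACA.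
      rewrite normrZ exprMn ger0_norm// -natrX mulr_natl lerMn2r /=.
      apply: dM; apply: (MD) => //; rewrite -[_ *: m']addr0; exact: MD.
    have : `|p| ^+ 2 + `|m' - m| ^+ 2 < `|p| ^+ 2 + (e * 2) ^+ 2.
      rewrite sum_eq (@lt_le_trans _ _ (((d + e ^+ 2) + (d + e ^+ 2)) *+ 2))//.
        by rewrite ltrMn2r /= ltrD.
      rewrite (_ : _ *+ 2 = d *+ 4 + (e * 2) ^+ 2) ?lerD2r//.
      by rewrite -mulr_natl; ring.
    by rewrite ltrD2l.
exists z; first by move=> B /(Az 1 ltr01)[x [[Mx _] Bx]]; exists x.
move=> m Mm; have [->|m0] := eqVneq m 0; first by rewrite linear0r.
rewrite innerBl; apply/eqP; rewrite subr_eq0 eq_sym; apply/eqP.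
apply: (@inner_limit A `|m|) => //; first by rewrite normr_gt0.
move=> e x e0 [Mx yx]; rewrite -innerBl -ler_pdivrMr ?normr_gt0//.
rewrite -ler_sqr ?nnegrE ?divr_ge0 ?(ltW e0)//.
have := norm_sub_proj (y - x) m m0.
set c := _ / _ => dc.
have : d <= `|y - x - c *: m| ^+ 2.
  by rewrite -addrA -opprD; apply: dM; rewrite addrC; apply: MD.
rewrite dc lerBrDr addrC -lerBrDr => le_sq.
by rewrite (le_trans le_sq)// lerBlDl ltW.
Qed.

(** For [y] with projection [z] on the closure of [M], the difference [y - z] is
    orthogonal to [M], hence zero. *)
Lemma orthogonal_dense M : subspace M ->
  (forall w, (forall m, M m -> inner w m = 0) -> w = 0) -> closure M = setT.
Proof.
move=> sM M0; apply/seteqP; split=> // y _.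
have [z Mz yz] := orthogonal_projection M y sM.
by rewrite (subr0_eq (M0 _ yz)).
Qed.

Lemma dense_orthogonal M w : closure M = setT ->
  (forall m, M m -> inner m w = 0) -> w = 0.
Proof.
move=> cM Mw; apply: inner_eq0.
apply: (@inner_limit (fun=> M) 1) => // [e e0|e x e0 Mx]; first by rewrite cM.
by rewrite Mw// subrr normr0 mulr1 ltW.
Qed.

End HilbertSpace.

(** * Symmetric and selfadjoint operators *)

Section Operators.
Context {R : realType} {H : hilbertType R}.
Variable S : operator H.
Hypothesis S_linear : linear_operator S.
Implicit Types (x y z h k u v w : H) (e mu : R[i]).

Lemma dom_subspace : subspace (dom S).
Proof. by case: S_linear. Qed.

Lemma op_sub x y : dom S x -> dom S y -> dom S (x - y) /\ S (x - y) = S x - S y.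
Proof.
case: S_linear => S0 SD SE Sx Sy.
rewrite -scaleN1r addrC -[in S x - _]scaleN1r [in RHS]addrC SE//.
by split=> //; exact: SD.
Qed.

Lemma ran_add_subspace mu : subspace (ran (scalar_add mu S)).
Proof.
case: S_linear => S0 SD SE; split.
  exists 0 => //=; rewrite scaler0 add0r.
  by have := op_sub _ _ S0 S0; rewrite !subrr => -[].
move=> a _ _ [x Sx <-] [y Sy <-]; exists (a *: x + y); first exact: SD.
by rewrite /= SE// !scalerDr !scalerA [mu * a]mulrC addrACA.
Qed.

Lemma ran_subN mu :
  ran (scalar_sub mu S) = [set - y | y in ran (scalar_add (- mu) S)].
Proof.
apply/seteqP; split=> [_ [x Sx <-]|_ [_ [x Sx <-] <-]].
  by exists (- mu *: x + S x); [exists x | rewrite scaleNr opprD opprK].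
by exists x => //=; rewrite scaleNr opprD opprK.
Qed.

(** [inner x (S x)] is real by symmetry, and [mu] is imaginary, so the cross
    terms cancel.  Hence [|mu| |x| <= |mu x + S x|], which makes preimages
    depend continuously on their images. *)
Lemma norm_imaginary_add mu x : symmetric_operator S -> Num.conj mu = - mu ->
  dom S x -> `|mu *: x + S x| ^+ 2 = `|mu| ^+ 2 * `|x| ^+ 2 + `|S x| ^+ 2.
Proof.
move=> symS mu_imag Sx.
rewrite -!inner_norm dnormD dnormZ innerZl /= rmorphM /= mu_imag -innerC symS//.
by rewrite mulNr subrr addr0.
Qed.

Lemma selfadjoint_symmetric : selfadjoint S -> symmetric_operator S.
Proof.
move=> [_ [dS eS]] h k Sh Sk; rewrite (eS k Sk) /=.
have /xgetPex : adjoint_values S k !=set0 by move: Sk; rewrite {1}dS.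
exact.
Qed.

(** Membership in the graph of the adjoint gives membership in the graph of [S]:
    by density of the domain, [h'] is the only possible value of the adjoint
    at [k]. *)
Lemma selfadjoint_adjoint k h' : selfadjoint S ->
  (forall h, dom S h -> inner (S h) k = inner h h') -> dom S k /\ S k = h'.
Proof.
move=> saS kh'; have [denseS [dS eS]] := saS.
have Sk : dom S k by rewrite dS; exists h'.
split=> //; apply/subr0_eq/(dense_orthogonal (dom S)); first exact/denseP.
move=> h Sh; rewrite innerBr -kh'// -selfadjoint_symmetric ?subrr//.
Qed.

(** Density of the range uses that an orthogonal vector would be an eigenvector
    of [S] with the non-real eigenvalue [mu]; surjectivity follows since
    approximate preimages of a point are Cauchy and [S], being an adjoint, is
    closed. *)
Lemma selfadjoint_ran mu : mu != 0 -> Num.conj mu = - mu -> selfadjoint S ->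
  ran (scalar_add mu S) = setT.
Proof.
move=> mu0 mu_imag saS; have symS := selfadjoint_symmetric saS.
have nmu0 : 0 < `|mu| by rewrite normr_gt0.
have ran_dense : closure (ran (scalar_add mu S)) = setT.
  apply: orthogonal_dense; first exact: ran_add_subspace.
  move=> k k_ran.
  have [Sk Ske] : dom S k /\ S k = mu *: k.
    apply: selfadjoint_adjoint => // h Sh.
    have /eqP := k_ran _ (ex_intro2 _ _ h Sh erefl).
    rewrite /= innerDr addrC addr_eq0 => /eqP.
    rewrite innerZr mu_imag mulNr opprK => kSh.
    by rewrite innerZr mu_imag innerC [inner h k]innerC kSh rmorphM /= mu_imag.
  apply: inner_eq0; apply/eqP; have := symS k k Sk Sk.
  rewrite Ske innerZl innerZr mu_imag => /eqP.
  rewrite -subr_eq0 mulNr opprK -mulr2n mulrn_eq0 /= mulf_eq0.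
  by rewrite (negPf mu0).
apply/seteqP; split=> // y _.
(* By [norm_imaginary_add], [A e] has diameter at most [2 e / |mu|]. *)
pose A e := [set h | dom S h /\ `|y - (mu *: h + S h)| < e].
have [h Ah] : exists h, forall e, 0 < e -> closure (A e) h.
  apply: (@cantor_intersection _ _ A (2 / `|mu|)); first by rewrite divr_gt0.
  - move=> e e0; have : closure (ran (scalar_add mu S)) y by rewrite ran_dense.
    by move=> /closure_distP/(_ e e0)[_ [h Sh <-] yh]; exists h.
  - by move=> e e' _ ee' x [Sx yx]; split=> //; exact: lt_le_trans ee'.
  - move=> e x x' e0 [Sx yx] [Sx' yx'].
    rewrite mulrA ltr_pdivlMr// mulrC.
    have [Sxx' Sxx'E] := op_sub _ _ Sx Sx'.
    apply: (@le_lt_trans _ _ `|mu *: (x - x') + S (x - x')|).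
      rewrite -ler_sqr ?nnegrE ?mulr_ge0// norm_imaginary_add// exprMn.
      by rewrite lerDl exprn_ge0.
    rewrite Sxx'E scalerBr addrACA -opprD.
    rewrite -(subrK y (mu *: x + _)) -addrA.
    rewrite (le_lt_trans (ler_normD _ _))// mulr_natr mulr2n ltrD//.
    by rewrite distrC.
have [Sh She] : dom S h /\ S h = y - mu *: h.
  apply: selfadjoint_adjoint => // x Sx.
  (* For [h'] in [A e], moving [S] and [mu] to the left-hand argument turns the
     difference of the two sides into the inner product of [x] with the residual
     of [h']. *)
  have hx : inner h (S x - mu *: x) = inner y x.
    (* The added 1 only keeps the constant positive when [x = 0]. *)
    apply: (@inner_limit _ _ A (`|x| + 1)) => // e h' e0 [Sh' yh'].
    have -> : inner y x - inner h' (S x - mu *: x) =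
        inner (y - (mu *: h' + S h')) x.
      rewrite [RHS]innerBl innerDl innerZl innerBr innerZr mu_imag symS//.
      by rewrite mulNr opprK [mu * _ + _]addrC.
    rewrite (le_trans (cauchy_schwarz _ _))// ler_pM ?(ltW yh')//.
    by rewrite lerDl.
  have {}hx : inner h (S x) = inner y x + inner h (mu *: x).
    by rewrite -hx -innerDr subrK.
  rewrite [LHS]innerC hx rmorphD /= -!innerC innerZl innerBr innerZr mu_imag.
  by rewrite mulNr opprK.
by exists h => //=; rewrite She addrC subrK.
Qed.

(** The identity [sym_sub] says that [mu - S] is minus the formal adjoint of
    [mu + S]: solvability for [mu + S], with density of the range of
    [mu - S], gives both the density of the domain and the inclusion of
    the adjoint in [S]. *)
Lemma selfadjoint_of_ran mu : Num.conj mu = - mu -> symmetric_operator S ->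
  ran (scalar_add mu S) = setT -> closure (ran (scalar_sub mu S)) = setT ->
  selfadjoint S.
Proof.
move=> mu_imag symS ranS dense_ran.
have sym_sub x y : dom S x -> dom S y ->
    inner (mu *: x - S x) y = - inner x (mu *: y + S y).
  move=> Sx Sy; rewrite innerBl innerZl innerDr innerZr mu_imag symS//.
  by rewrite opprD mulNr opprK.
have denseS : closure (dom S) = setT.
  apply: orthogonal_dense; first exact: dom_subspace.
  move=> k kS; have [h Sh hk] : ran (scalar_add mu S) k by rewrite ranS.
  suff h0 : h = 0.
    rewrite -hk h0 /= scaler0 add0r; case: S_linear => S0 _ _.
    by have := op_sub _ _ S0 S0; rewrite !subrr => -[].
  apply: (dense_orthogonal _ _ dense_ran) => _ [x Sx <-] /=.
  rewrite sym_sub// -[mu *: h + S h]/(scalar_add mu S h) hk innerC kS//.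
  by rewrite conjC0 oppr0.
have adjP h k' : (forall x, dom S x -> inner (S x) h = inner x k') ->
    dom S h /\ S h = k'.
  move=> hk'.
  have [g Sg gk] : ran (scalar_add mu S) (mu *: h + k') by rewrite ranS.
  have hg : h = g.
    apply/subr0_eq/(dense_orthogonal _ _ dense_ran) => _ [x Sx <-] /=.
    rewrite innerBr (sym_sub x g)// -[mu *: g + S g]/(scalar_add mu S g) gk.
    rewrite innerBl innerZl hk'// innerDr innerZr mu_imag mulNr.
    by ring.
  by split; rewrite hg//; move: gk; rewrite hg /= => /addrI.
split; first exact/denseP.
have dS : dom S = dom (adjoint S).
  apply/seteqP; split=> [h Sh|h [k' hk']]; last by have [] := adjP h k' hk'.
  by exists (S h) => x Sx; exact: symS.
split=> // h Sh /=.
have /xgetPex hS : adjoint_values S h !=set0.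
  by exists (S h) => x Sx; exact: symS.
by have [_ ->] := adjP _ _ (hS 0).
Qed.

End Operators.

Theorem corollary3p3 (R : realType) (H : hilbertType R) (S : operator H)
    (S_linear : linear_operator S) :
  (selfadjoint S <->
     exists2 lambda : R, lambda != 0 &
       [/\ symmetric_operator S,
           ran (scalar_add (lambda%:C * 'i%C) S) = [set: H] &
           closure (ran (scalar_sub (lambda%:C * 'i%C) S)) = [set: H]])
  /\
  (selfadjoint S <->
     forall lambda : R, lambda != 0 ->
       [/\ symmetric_operator S,
           ran (scalar_add (lambda%:C * 'i%C) S) = [set: H] &
           closure (ran (scalar_sub (lambda%:C * 'i%C) S)) = [set: H]]).
Proof.
have ii_of_i : selfadjoint S -> forall lambda : R, lambda != 0 ->
    [/\ symmetric_operator S,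
        ran (scalar_add (lambda%:C * 'i%C) S) = [set: H] &
        closure (ran (scalar_sub (lambda%:C * 'i%C) S)) = [set: H]].
  move=> saS lambda l0; have [mu0 mu_imag] := scalar_i_imaginary lambda l0.
  have symS := selfadjoint_symmetric S saS.
  have ran_add := selfadjoint_ran S S_linear _ mu0 mu_imag saS.
  split=> //.
  set mu := lambda%:C * _ in mu0 mu_imag *.
  have ran_addN : ran (scalar_add (- mu) S) = setT.
    apply: selfadjoint_ran => //; first by rewrite oppr_eq0.
    by rewrite rmorphN /= mu_imag.
  rewrite ran_subN ran_addN.
  apply/seteqP; split=> // y _; apply: subset_closure.
  by exists (- y); rewrite ?opprK.
have i_of_ii : forall lambda : R, lambda != 0 ->
    [/\ symmetric_operator S,
        ran (scalar_add (lambda%:C * 'i%C) S) = [set: H] &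
        closure (ran (scalar_sub (lambda%:C * 'i%C) S)) = [set: H]] ->
    selfadjoint S.
  move=> lambda l0 [symS ranS dranS].
  have [_ mu_imag] := scalar_i_imaginary lambda l0.
  exact: (selfadjoint_of_ran S S_linear _ mu_imag symS ranS dranS).
split; split.
- move=> saS; exists 1; first exact: oner_neq0.
  by apply: ii_of_i => //; exact: oner_neq0.
- by move=> [lambda l0 ii]; exact: i_of_ii ii.
- exact: ii_of_i.
- move=> ii; have l1 : (1 : R) != 0 by exact: oner_neq0.
  exact: i_of_ii l1 (ii 1 l1).
Qed.
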